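(* Let $q$ be a prime power. Then \begin{align*} \pi(PG_{2}(q))\ge&\max\Big\{(q+1)!\sum_{i=1}^{q}\sum_{j=\max\{0,q+2-M(q)-i\}}^{\min\{2,q+1-i\}}\frac{1}{i!j!}\binom{M(q)-1}{q+1-i-j}\alpha^{i}\beta^{j}\gamma^{q+1-i-j}:\\ &\alpha,\beta,\gamma\ge0,\ \alpha+\beta+(M(q)-1)\gamma=1\Big\}. \end{align*} In particular, (1) $\pi(PG_{2}(3))\ge0.7364719055$, (2) $\pi(PG_{2}(4))\ge0.7381611274$, (3) $\pi(PG_{2}(5))\ge0.7440388117$, (4) $\pi(PG_{2}(7))\ge0.7583661147$, (5) $\pi(PG_{2}(8))\ge0.7654160822$.
   Context: $PG_{2}(q)$ is the projective plane over $\mathbb{F}_q$, regarded as the $(q+1)$-uniform hypergraph whose vertices are its points (one-dimensional subspaces of $\mathbb{F}_q^{3}$) and whose edges are its lines (sets of points in a two-dimensional subspace). A $k$-arc is a set of $k$ points of $PG_2(q)$, no three collinear; an arc is complete if it is not contained in a larger arc. For an arc $K$, $m(K)$ denotes the minimum size of a set $Q$ of points such that $PG_{2}(q)\setminus(K\cup Q)$ contains no line, and $M(q)=\min\{m(K): K\text{ a complete arc in }PG_{2}(q)\}$. For an $r$-uniform hypergraph $\mathcal{H}$, $\mathrm{ex}(n,\mathcal{H})$ is the maximum number of edges in an $n$-vertex $r$-uniform hypergraph containing no subhypergraph isomorphic to $\mathcal{H}$, and the Turán density is $\pi(\mathcal{H})=\lim_{n\to\infty}\mathrm{ex}(n,\mathcal{H})/\binom{n}{r}$.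 *)

(* Defs.v *)
From mathcomp Require Import all_boot all_order all_algebra.
From mathcomp Require Import all_classical all_reals all_analysis.

Set Implicit Arguments.
Unset Strict Implicit.
Unset Printing Implicit Defensive.

Import Order.TTheory GRing.Theory Num.Theory.
Import numFieldNormedType.Exports.

Local Open Scope nat_scope.

(* A hypergraph on the vertex set T is given by its edge set E : {set {set T}}. *)

Definition uniform_hypergraph (T : finType) (r : nat) (E : {set {set T}}) :=
  [forall e in E, #|e| == r].

(* The image of H under f is the subhypergraph of G isomorphic to H. *)
Definition contains_copy (S T : finType)
    (H : {set {set S}}) (G : {set {set T}}) :=
  [exists f : {ffun S -> T},
     injectiveb f && (((fun e : {set S} => f @: e) @: H) \subset G)].

Definition turan_number (S : finType) (r n : nat) (H : {set {set S}}) : nat :=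
  \max_(G : {set {set 'I_n}} |
          uniform_hypergraph r G && ~~ contains_copy H G) #|G|.

Definition turan_density (R : realType) (S : finType) (r : nat)
    (H : {set {set S}}) : R :=
  limn (fun n => (turan_number r n H)%:R / 'C(n, r)%:R : R)%R.
Arguments turan_density R {S} r H.

(* A subspace of F^3 is the row space of a 3 x 3 matrix; the fixed points of
   genmx (written <<A>>) are the canonical representatives, one per subspace. *)
Definition pg_point (F : finFieldType) : finType :=
  {A : 'M[F]_3 | (\rank A == 1) && (<<A>>%MS == A)}.

Definition line_of (F : finFieldType) (L : 'M[F]_3) : {set pg_point F} :=
  finset (fun p : pg_point F => (sval p <= L)%MS).

Definition PG2 (F : finFieldType) : {set {set pg_point F}} :=
  @line_of F @: [pred L : 'M[F]_3 | \rank L == 2].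

Definition collinear (F : finFieldType) (S : {set pg_point F}) :=
  [exists e in PG2 F, S \subset e].

Definition pg_arc (F : finFieldType) (K : {set pg_point F}) :=
  [forall S : {set pg_point F},
     (S \subset K) && (#|S| == 3) ==> ~~ collinear S].

Definition complete_arc (F : finFieldType) (K : {set pg_point F}) :=
  maxset (@pg_arc F) K.

Definition leaves_no_line (F : finFieldType) (K Q : {set pg_point F}) :=
  [forall e in PG2 F, ~~ (e \subset ~: (K :|: Q))].

Lemma line_of_neq0 (F : finFieldType) (L : 'M[F]_3) :
  \rank L == 2 -> line_of L != finset.set0.
Proof.
move=> rkL; have /row_subPn[i nzi] : ~~ (L <= (0%R : 'M[F]_3))%MS.
  by rewrite submx0 -mxrank_eq0 (eqP rkL).
rewrite submx0 in nzi.
have Pi : (\rank <<row i L>>%MS == 1) && (<<<<row i L>>>>%MS == <<row i L>>%MS).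
  by rewrite genmx_id eqxx andbT genmxE rank_rV nzi.
apply/set0Pn.
exists (Sub <<row i L>>%MS Pi :
  {A : 'M[F]_3 | (\rank A == 1) && (<<A>>%MS == A)}).
by rewrite inE /= genmxE row_sub.
Qed.

Lemma m_arc_subproof (F : finFieldType) (K : {set pg_point F}) :
  exists k, [exists Q, leaves_no_line K Q && (#|Q| == k)].
Proof.
exists #|pg_point F|; apply/existsP; exists [set: pg_point F]%SET.
rewrite cardsT eqxx andbT; apply/forall_inP => e /imsetP[L rkL ->].
by rewrite finset.setUT finset.setCT finset.subset0 line_of_neq0.
Qed.

Definition m_arc (F : finFieldType) (K : {set pg_point F}) : nat :=
  ex_minn (m_arc_subproof K).

Lemma M_arc_subproof (F : finFieldType) :
  exists k, [exists K : {set pg_point F}, complete_arc K && (m_arc K == k)].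
Proof.
have arc0 : pg_arc (finset.set0 : {set pg_point F}).
  apply/forallP => S; apply/implyP => /andP[].
  by rewrite finset.subset0 => /eqP->; rewrite cards0.
have [K maxK _] := maxset_exists arc0.
by exists (m_arc K); apply/existsP; exists K; rewrite eqxx andbT.
Qed.

Definition M_arc (F : finFieldType) : nat := ex_minn (M_arc_subproof F).

(* The truncated subtraction q + 2 - M - i is max {0, q + 2 - M - i}; all other
   subtractions here are exact in the ranges of summation, since M_arc F > 0. *)
Definition objective (R : realType) (q M : nat) (a b c : R) : R :=
  ((q.+1)`!%:R *
   \sum_(1 <= i < q.+1)
     \sum_(q + 2 - M - i <= j < (minn 2 (q + 1 - i)).+1)
       1 / (i`!%:R * j`!%:R) * 'C(M - 1, q + 1 - i - j)%:R
         * a ^+ i * b ^+ j * c ^+ (q + 1 - i - j))%R.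

Definition objective_values (R : realType) (q M : nat) : set R :=
  (fun x : R => exists a b c : R,
     [/\ 0 <= a, 0 <= b, 0 <= c, a + b + (M - 1)%:R * c = 1
       & x = objective q M a b c])%R.
Arguments objective_values R q M x : clear implicits.

Definition is_max (R : realType) (A : set R) (m : R) := A m /\ ubound A m.

(* decimal [:: d1; ...; dk] is the decimal fraction 0.d1...dk; a ten-digit
   numeral in ring_scope would be expanded in unary. *)
Definition decimal (R : realType) (ds : seq nat) : R :=
  foldr (fun d x => (d%:R + x) / 10)%R 0%R ds.
Arguments decimal R ds : clear implicits.

(* Main.v *)
(* Split the n vertices into classes A, B and C_1, ..., C_(M-1), M = M(q), and
   take as edges the (q+1)-sets that meet A without being contained in it, meet
   B in at most 2 vertices and each C_k in at most one.  In a copy of PG_2(q) the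
   points in B would form an arc, those in the C_k, at most one per class since
   two points are always on a line, would be a set of at most M - 1 points, and
   every line would meet the union of the two; extending the arc to a complete
   one contradicts the definition of M.  Assigning each vertex at random to A, B
   or C_k with probabilities alpha, beta, gamma makes the expected number of
   edges exactly binom(n, q+1) times the objective.

   The numerical bounds need M(q) >= q - 1 for q = 3, 4, 5, 7, 8, which follows by
   counting, for an arc K of k points, the lines external to K: their number is
   determined by k and a point lies on at most q + 1 - k/2 of them, which is
   enough unless (q, k) = (7, 6), (8, 8) or (8, 6).  In these cases a blocking
   set Q of q - 2 points has almost no slack.  Comparing the externals through
   the points of a secant bounds the number of points of Q on it, while some
   point of Q is on no tangent and shares no external line with another point of
   Q, so that the rest of Q would have to fit on the k/2 secants through it. *)

Require Import Defs.
From mathcomp Require Import all_boot all_order all_algebra.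
From mathcomp Require Import all_classical all_reals all_analysis.
From mathcomp Require Import mxabelem.
From mathcomp Require Import zify ring lra.

Set Implicit Arguments.
Unset Strict Implicit.
Unset Printing Implicit Defensive.

Import Order.TTheory GRing.Theory Num.Theory.
Import numFieldNormedType.Exports.
Local Open Scope ring_scope.

(** * Turan numbers *)

(** An edge of [H] keeps the edgeless hypergraph free of copies, so the maximum is over a nonempty
    family and is attained. *)
Lemma turan_number_witness (S : finType) (r n : nat) (H : {set {set S}}) :
  H != finset.set0 ->
  exists2 G : {set {set 'I_n}},
    uniform_hypergraph r G && ~~ contains_copy H G & #|G| = turan_number r n H.
Proof.
move=> /set0Pn[h hH].
have P0 : uniform_hypergraph r (finset.set0 : {set {set 'I_n}}) &&
          ~~ contains_copy H (finset.set0 : {set {set 'I_n}}).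
  apply/andP; split; first by apply/forall_inP => e; rewrite finset.in_set0.
  apply/existsP => -[f /andP[_ /fintype.subsetP /(_ (f @: h))]].
  by rewrite finset.in_set0; move=> /(_ (imset_f _ hH)).
rewrite /turan_number.
have [|G PG ->] := @eq_bigmax_cond {set {set 'I_n}}
    [pred G | uniform_hypergraph r G && ~~ contains_copy H G] (fun G => #|G|).
  by apply/fintype.card_gt0P; exists finset.set0.
by exists G.
Qed.

Lemma turan_number_ge (S : finType) (r n : nat) (H : {set {set S}})
    (G : {set {set 'I_n}}) :
  uniform_hypergraph r G -> ~~ contains_copy H G ->
  (#|G| <= turan_number r n H)%N.
Proof.
move=> uG cG; apply: (@leq_bigmax_cond {set {set 'I_n}}
  [pred G | uniform_hypergraph r G && ~~ contains_copy H G] (fun G => #|G|)).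
by rewrite inE uG.
Qed.

(** Averaging over vertex deletions: an edge of an extremal hypergraph on [n.+1] vertices survives
    [n.+1 - r] of the [n.+1] deletions, and each deletion leaves an [H]-free hypergraph. *)
Lemma turan_number_step (S : finType) (r n : nat) (H : {set {set S}}) :
  H != finset.set0 -> 
  ((n.+1 - r) * turan_number r n.+1 H <= n.+1 * turan_number r n H)%N.
Proof.
move=> H0; have [G /andP[uG cG] <-] := turan_number_witness r n.+1 H0.
(* [Gv v] is [G] with the vertex [v] deleted, relabelled on ['I_n] through [lift v]. *)
pose Gv (v : 'I_n.+1) := [set e : {set 'I_n} | lift v @: e \in G].
have Gvle v : (#|Gv v| <= turan_number r n H)%N.
  apply: turan_number_ge.
    apply/forall_inP => e; rewrite inE => /(forall_inP uG).
    by rewrite card_imset //; exact: lift_inj.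
  apply: contra cG => /existsP[f /andP[/injectiveP injf /fintype.subsetP sub]].
  apply/existsP; exists [ffun x => lift v (f x)]; apply/andP; split.
    by apply/injectiveP => x y; rewrite !ffunE => /lift_inj /injf.
  apply/fintype.subsetP => _ /imsetP[e eH ->].
  have := sub _ (imset_f (fun e : {set S} => f @: e) eH); rewrite inE -imset_comp.
  by rewrite (@eq_imset _ _ (lift v \o f) [ffun x => lift v (f x)]) // => x;
     rewrite ffunE.
have cardGv v : #|Gv v| = #|[set e in G | v \notin e]|.
  rewrite -(card_imset (Gv v) (imset_inj (@lift_inj _ v))).
  apply: eq_card => e; rewrite inE; apply/imsetP/andP.
    move=> [e' + ->]; rewrite inE => ->; split=> //.
    by apply/negP => /imsetP[x _ /eqP]; rewrite (negPf (neq_lift _ _)).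
  move=> [eG ve]; exists (lift v @^-1: e).
    rewrite inE; suff -> : lift v @: (lift v @^-1: e) = e by [].
    apply/setP => x; apply/imsetP/idP.
      by move=> [y]; rewrite inE => ? ->.
    move=> xe; case: (unliftP v x) => [y xy|xv].
      by exists y => //; rewrite inE -xy.
    by rewrite xv (negPf ve) in xe.
  apply/setP => x; apply/idP/imsetP.
    move=> xe; case: (unliftP v x) => [y xy|xv].
      by exists y => //; rewrite inE -xy.
    by rewrite xv (negPf ve) in xe.
  by move=> [y]; rewrite inE => ? ->.
have -> : ((n.+1 - r) * #|G| = \sum_(v : 'I_n.+1) #|Gv v|)%N.
  under eq_bigr => v _ do rewrite cardGv -sum1_card.
  rewrite mulnC -sum_nat_const.
  rewrite (exchange_big_dep (fun e => e \in G)) /=; last first.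
    by move=> v e _; rewrite inE => /andP[].
  apply: eq_bigr => e eG.
  rewrite sum1_card -(eqP (forall_inP uG _ eG)) -[in RHS]cardsE.
  have -> : [set v : 'I_n.+1 | e \in [set e0 in G | v \notin e0]] = ~: e.
    by apply/setP => v; rewrite !inE eG.
  by rewrite [RHS]cardsCs finset.setCK card_ord.
apply: (@leq_trans (\sum_(v : 'I_n.+1) turan_number r n H)%N).
  exact: leq_sum.
by rewrite sum_nat_const card_ord.
Qed.

Lemma turan_ratio_is_cvg (R : realType) (S : finType) (r : nat)
    (H : {set {set S}}) :
  H != finset.set0 ->
  cvgn (fun n => (turan_number r n H)%:R / 'C(n, r)%:R : R).
Proof.
move=> H0; set u := fun n => _.
(* The shift by [r] skips the indices at which the binomial coefficient is 0 and the quotient takes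
   its default value 0. From there on the averaging step makes the ratio nonincreasing. *)
suff /cvg_ex[l] : cvgn [sequence u (n + r)%N]_n.
  by rewrite cvg_shiftn => ul; apply/cvg_ex; exists l.
apply: nonincreasing_is_cvgn.
  apply/nonincreasing_seqP => n; rewrite /u /= addSn.
  set m := (n + r)%N.
  have rm : (r <= m)%N by rewrite leq_addl.
  have C1 : (0 < 'C(m, r))%N by rewrite bin_gt0.
  have C2 : (0 < 'C(m.+1, r))%N by rewrite bin_gt0 leqW.
  rewrite ler_pdivrMr ?ltr0n // mulrAC ler_pdivlMr ?ltr0n // -!natrM ler_nat.
  have step := turan_number_step r m H0.
  have p0 : (0 < m.+1 - r)%N by lia.
  rewrite -(leq_pmul2l p0) mulnA.
  apply: leq_trans (leq_mul step (leqnn _)) _.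
  by rewrite mulnCA -(mul_bin_down m.+1) /=; lia.
exists 0 => _ [n _ <-].
by rewrite divr_ge0 ?ler0n.
Qed.

Lemma turan_density_ge (R : realType) (S : finType) (r : nat)
    (H : {set {set S}}) (p : R) :
  H != finset.set0 ->
  (forall n, p * 'C(n, r)%:R <= (turan_number r n H)%:R) ->
  p <= turan_density R r H.
Proof.
move=> H0 ple; apply: limr_ge; first exact: turan_ratio_is_cvg.
exists r => // n /= rn.
by rewrite ler_pdivlMr ?ltr0n ?bin_gt0.
Qed.

(** * The random colouring construction *)

Notation colour N := (option (option 'I_N)).

(* [None] is the class A, [Some None] the class B, and [Some (Some k)] the
   class C_k. *)
Definition well_coloured (T : finType) (N q : nat) (f : T -> colour N)
    (e : {set T}) :=
  [&& (0 < #|[set x in e | f x == None]| <= q)%N,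
      (#|[set x in e | f x == Some None]| <= 2)%N
    & [forall k, (#|[set x in e | f x == Some (Some k)]| <= 1)%N]].

Section RandomColouring.
Variables (R : realType) (T : finType) (N : nat) (a b c : R).
Hypotheses (a0 : 0 <= a) (b0 : 0 <= b) (c0 : 0 <= c).
Hypothesis abc1 : a + b + N%:R * c = 1.

Definition colour_weight (x : colour N) : R :=
  match x with None => a | Some None => b | Some (Some _) => c end.

Definition colouring_weight (f : {ffun T -> colour N}) : R :=
  \prod_x colour_weight (f x).

Lemma colouring_weight_ge0 f : 0 <= colouring_weight f.
Proof. by apply: prodr_ge0 => x _; case: (f x) => [[]|]. Qed.

Lemma sum_colour_weight : \sum_x colour_weight x = 1.
Proof.
have opt (U : finType) (F : option U -> R) :
    \sum_x F x = F None + \sum_x F (Some x).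
  rewrite (bigD1 None) //=; congr (_ + _).
  rewrite (reindex_omap Some id) /=; last by case.
  by apply: eq_bigl => x; rewrite eqxx.
by rewrite !opt /= sumr_const card_ord -mulr_natl addrA.
Qed.

Lemma sum_colouring_weight : \sum_f colouring_weight f = 1.
Proof.
rewrite -(bigA_distr_bigA (fun _ => colour_weight)).
by rewrite big1 // => x _; exact: sum_colour_weight.
Qed.

(** With the A-part [X] and the B-part [Y] of [e] fixed, a colouring amounts to an injection [h] of
    the rest of [e] into the classes C_k, counted by the falling factorial, and a free choice off
    [e], of total weight 1. *)
Lemma pattern_weight_le (e X Y : {set T}) :
  X \subset e -> Y \subset e :\: X ->
  a ^+ #|X| * b ^+ #|Y| * c ^+ (#|e| - #|X| - #|Y|)
    * (N ^_ (#|e| - #|X| - #|Y|))%:R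
  <= \sum_(f : {ffun T -> colour N} | [forall k, (#|[set x in e | f x == Some (Some k)]| <= 1)%N]
               && (([set x in e | f x == None],
                    [set x in e | f x == Some None]) == (X, Y)))
       colouring_weight f.
Proof.
move=> Xe Ye.
pose W := (e :\: X) :\: Y.
have cardW : #|W| = (#|e| - #|X| - #|Y|)%N.
  rewrite cardsD (finset.setIidPr Ye) cardsD.
  by move/finset.setIidPr : Xe => ->.
rewrite -cardW.
pose D := {x | x \in W}.
have cardD : #|{: D}| = #|W| by rewrite card_sig.
(* Colours are forced on [e] by [X], [Y] and [h], and free elsewhere. Being a product condition on
   the points, it lets the sum of weights factor. *)
pose allowed (h : {ffun D -> 'I_N}) (x : T) : pred (colour N) :=
  fun k => match insub x : option D with
  | Some u => k == Some (Some (h u))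
  | None => if x \in X then k == None
            else if x \in Y then k == Some None else true
  end.
have XD h x : x \in X -> allowed h x =1 pred1 None.
  move=> xX k; rewrite /allowed insubN ?xX // !inE xX /= andbF.
  by [].
have YD h x : x \in Y -> allowed h x =1 pred1 (Some None).
  move=> xY k; rewrite /allowed insubN ?inE ?xY //.
  have := fintype.subsetP Ye x xY; rewrite !inE => /andP[/negPf-> _].
  by [].
have WD h (u : D) : allowed h (val u) =1 pred1 (Some (Some (h u))).
  by move=> k; rewrite /allowed valK.
have OD h x : x \notin e -> allowed h x =1 predT.
  move=> xe k; rewrite /allowed insubN ?inE ?(negPf xe) ?andbF //.
  case: ifP => [/(fintype.subsetP Xe)|_]; first by rewrite (negPf xe).
  case: ifP => // /(fintype.subsetP Ye).
  by rewrite inE (negPf xe) andbF.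
have sumh h : \sum_(f in family (allowed h)) colouring_weight f
    = a ^+ #|X| * b ^+ #|Y| * c ^+ #|W|.
  rewrite -(bigA_distr_big_dep _ (fun _ => colour_weight)).
  transitivity (\prod_x ((if x \in X then a else 1) *
     (if x \in Y then b else 1) * (if x \in W then c else 1))).
    apply: eq_bigr => x _.
    case: (boolP (x \in e)) => xe; last first.
      rewrite (eq_bigl _ _ (OD h x xe)) sum_colour_weight.
      rewrite !inE (negPf xe) !andbF.
      rewrite (contraNF (fintype.subsetP Xe x)) //.
      rewrite (contraNF (fintype.subsetP Ye x)) ?mulr1 //.
      by rewrite inE (negPf xe) andbF.
    case: (boolP (x \in X)) => xX.
      rewrite (eq_bigl _ _ (XD h x xX)) big_pred1_eq /= !inE xX /= andbF mulr1.
      case: ifP => [/(fintype.subsetP Ye)|_]; last by rewrite !mulr1.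
      by rewrite inE xX.
    case: (boolP (x \in Y)) => xY.
      by rewrite (eq_bigl _ _ (YD h x xY)) big_pred1_eq /= !inE xY /= mulr1 mul1r.
    have xW : x \in W by rewrite !inE xX xY xe.
    rewrite xW (eq_bigl _ _ (WD h (exist _ x xW))) big_pred1_eq /=.
    by rewrite !mul1r.
  by rewrite !big_split /= -!big_mkcond /= !prodr_const.
have -> : (N ^_ #|W|)%N = #|[set h : {ffun D -> 'I_N} | injectiveb h]|.
  by rewrite card_inj_ffuns cardD card_ord.
rewrite mulr_natr -sumr_const.
under eq_bigr => h _ do rewrite -(sumh h).
(* It remains to see, for each colouring [f], that at most one injective [h] is compatible with it,
   and none unless [f] has the required pattern on [e]. *)
rewrite (exchange_big_dep predT) //= [leRHS]big_mkcond /=.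
apply: ler_sum => f _; rewrite sumr_const.
set A := (X in _ *+ X).
have fh h x : f \in family (allowed h) -> allowed h x (f x).
  by move/familyP/(_ x).
have Ale1 : (A <= 1)%N.
  apply/card_le1_eqP => h h' /andP[_ hf] /andP[_ h'f].
  apply/ffunP => u; move: (fh _ (val u) hf) (fh _ (val u) h'f).
  by rewrite !WD /= => /eqP-> /eqP[->].
case: ifPn => [_|nf].
  by rewrite -[leRHS]mulr1n; apply: ler_wpMn2l => //; exact: colouring_weight_ge0.
suff -> : A = 0%N by rewrite mulr0n.
apply/eqP/pred0P => h /=; apply/negbTE; apply: contra nf => /andP[].
rewrite inE => /injectiveP hinj hf.
have fX x : x \in X -> f x = None.
  by move=> xX; have := fh _ x hf; rewrite XD // => /eqP.
have fY x : x \in Y -> f x = Some None.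
  by move=> xY; have := fh _ x hf; rewrite YD // => /eqP.
have fW (u : D) : f (val u) = Some (Some (h u)).
  by have := fh _ (val u) hf; rewrite WD // => /eqP.
have inW x : x \in e -> x \notin X -> x \notin Y -> exists u : D, x = val u.
  move=> xe xX xY; have xW : x \in W by rewrite !inE xX xY xe.
  by exists (exist _ x xW).
apply/andP; split.
  apply/forallP => k; apply/card_le1_eqP => x y; rewrite !inE.
  have aux z : z \in e -> f z = Some (Some k) -> exists2 u, z = val u & h u = k.
    move=> ze fz; have [||u zu] := inW z ze.
    - by apply/negP => /fX; rewrite fz.
    - by apply/negP => /fY; rewrite fz.
    by exists u => //; move: fz; rewrite zu fW => -[].
  move=> /andP[xe /eqP/(aux _ xe)[u -> hu]] /andP[ye /eqP/(aux _ ye)[v -> hv]].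
  by congr val; apply: hinj; rewrite hu hv.
have YE x : x \in Y -> (x \in e) && (x \notin X).
  by move/(fintype.subsetP Ye); rewrite inE andbC.
apply/eqP; congr pair; apply/setP => x; rewrite inE.
  apply/andP/idP => [[xe /eqP fx]|xX].
    apply: contraT => xX; have xY : x \notin Y.
      by apply/negP => /fY; rewrite fx.
    by have [u xu] := inW x xe xX xY; move: fx; rewrite xu fW.
  by rewrite fX // (fintype.subsetP Xe).
apply/andP/idP => [[xe /eqP fx]|xY].
  apply: contraT => xY; have xX : x \notin X.
    by apply/negP => /fX; rewrite fx.
  by have [u xu] := inW x xe xX xY; move: fx; rewrite xu fW.
by rewrite fY //; case/andP: (YE _ xY) => ->.
Qed.

End RandomColouring.

Lemma sum_subsets_by_card (R : realType) (T : finType) (e : {set T}) (m n : nat)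
    (F : nat -> R) :
  \sum_(X : {set T} | (X \subset e) && (m <= #|X| < n)%N) F #|X|
  = \sum_(m <= i < n) 'C(#|e|, i)%:R * F i.
Proof.
rewrite big_geq_mkord /=.
transitivity (\sum_(i < n | (m <= i)%N)
    \sum_(X : {set T} | (X \subset e) && (#|X| == i)) F #|X|); last first.
  apply: eq_bigr => i _.
  rewrite (eq_bigr (fun=> F i)); last by move=> X /andP[_ /eqP->].
  by rewrite sumr_const -cards_draws mulr_natl cardsE.
rewrite (exchange_big_dep
  (fun X : {set T} => (X \subset e) && (m <= #|X| < n)%N)) /=; last first.
  by move=> i X mi /andP[-> /eqP->]; rewrite mi ltn_ord.
apply: eq_bigr => X /andP[Xe /andP[mX Xn]].
rewrite (big_pred1 (Ordinal Xn)) // => i; rewrite Xe /= -val_eqE /= eq_sym.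
by case: eqP => [->|_]; rewrite ?mX ?andbF.
Qed.

Lemma multinomial_coefficient (N r i j : nat) :
  (i + j <= r)%N ->
  ('C(r, i) * 'C(r - i, j) * N ^_ (r - i - j) * (i`! * j`!)
   = r`! * 'C(N, r - i - j))%N.
Proof.
move=> ijr.
have ir : (i <= r)%N by lia.
have jr : (j <= r - i)%N by lia.
rewrite -(bin_fact ir) -(bin_fact jr) -bin_ffact; lia.
Qed.

(** Pairs [(X, Y)] of sizes [i], [j], each with its injections into [N] classes, number (q+1)!/(i!
    j!) times binom(N, q+1-i-j). The lower limit on [j] says that at most [N] points remain for the
    C_k. *)
Lemma objective_sum_subsets (R : realType) (T : finType) (N q : nat)
    (a b c : R) (e : {set T}) : #|e| = q.+1 ->
  objective q N.+1 a b c
  = \sum_(X : {set T} | (X \subset e) && (1 <= #|X| < q.+1)%N)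
     \sum_(Y : {set T} | (Y \subset e :\: X) &&
         (q + 2 - N.+1 - #|X| <= #|Y| < (minn 2 (q + 1 - #|X|)).+1)%N)
      (a ^+ #|X| * b ^+ #|Y| * c ^+ (#|e| - #|X| - #|Y|)
        * (N ^_ (#|e| - #|X| - #|Y|))%:R).
Proof.
move=> eq; rewrite /objective eq subSS subn0 !addn1.
pose G i := \sum_(q + 2 - N.+1 - i <= j < (minn 2 (q.+1 - i)).+1)
   'C(q.+1 - i, j)%:R *
   (a ^+ i * b ^+ j * c ^+ (q.+1 - i - j) * (N ^_ (q.+1 - i - j))%:R).
rewrite [RHS](eq_bigr (fun X : {set T} => G #|X|)); last first.
  move=> X /andP[Xe _].
  rewrite (sum_subsets_by_card (e :\: X) _ _ (fun j => a ^+ #|X| * b ^+ j *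
     c ^+ (q.+1 - #|X| - j) * (N ^_ (q.+1 - #|X| - j))%:R)).
  by rewrite cardsD (finset.setIidPr Xe) eq.
rewrite sum_subsets_by_card eq mulr_sumr.
rewrite [LHS]big_nat [RHS]big_nat; apply: eq_bigr => i /andP[i1 iq].
rewrite !mulr_sumr [LHS]big_nat [RHS]big_nat; apply: eq_bigr => j /andP[_ jq].
have ijq : (i + j <= q.+1)%N by move: jq; rewrite ltnS leq_min => /andP[]; lia.
have E : 'C(q.+1, i)%:R * 'C(q.+1 - i, j)%:R * (N ^_ (q.+1 - i - j))%:R
    * (i`!%:R * j`!%:R) = (q.+1)`!%:R * 'C(N, q.+1 - i - j)%:R :> R.
  by rewrite -!natrM multinomial_coefficient.
have i0 : i`!%:R != 0 :> R by rewrite pnatr_eq0 -lt0n fact_gt0.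
have j0 : j`!%:R != 0 :> R by rewrite pnatr_eq0 -lt0n fact_gt0.
transitivity ((q.+1)`!%:R * 'C(N, q.+1 - i - j)%:R / (i`!%:R * j`!%:R) *
  (a ^+ i * b ^+ j * c ^+ (q.+1 - i - j))).
  by field; rewrite i0 j0.
by rewrite -E; field; rewrite i0 j0.
Qed.

(** * From well-coloured edges to the Turán density *)

Section ColouredTuranBound.
Variables (R : realType) (N q : nat) (a b c : R).
Hypotheses (a0 : 0 <= a) (b0 : 0 <= b) (c0 : 0 <= c).
Hypothesis abc1 : a + b + N%:R * c = 1.

Lemma objective_le_well_coloured_weight (T : finType) (e : {set T}) :
  #|e| = q.+1 ->
  objective q N.+1 a b c
  <= \sum_(f : {ffun T -> colour N} | well_coloured q f e)
       colouring_weight a b c f.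
Proof.
move=> eq; rewrite (objective_sum_subsets N a b c eq).
rewrite pair_big_dep /=.
set P := (X in \sum_(p | X p) _).
pose cl (f : {ffun T -> colour N}) :=
  ([set x in e | f x == None], [set x in e | f x == Some None]).
pose inj (f : {ffun T -> colour N}) :=
  [forall k, (#|[set x in e | f x == Some (Some k)]| <= 1)%N].
apply: (@le_trans _ _ (\sum_(p | P p)
    \sum_(f | inj f && (cl f == p)) colouring_weight a b c f)).
  apply: ler_sum => -[X Y] /andP[/andP[Xe _] /andP[Ye _]].
  exact: pattern_weight_le.
(* The pair of colour classes is read off from [f], so no colouring is counted for two patterns. *)
have -> : \sum_(p | P p) \sum_(f | inj f && (cl f == p)) colouring_weight a b c f
    = \sum_(f | inj f && P (cl f)) colouring_weight a b c f.
  rewrite [RHS](partition_big cl P) /=; last by move=> f /andP[].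
  apply: eq_bigr => p Pp; apply: eq_bigl => f.
  by case: eqP => [->|_]; rewrite ?Pp ?andbT ?andbF.
rewrite big_mkcond [leRHS]big_mkcond; apply: ler_sum => f _.
case: ifPn => [/andP[injf /andP[/andP[_ /andP[X1 Xq]] /andP[_ /andP[_ Y2]]]]|_].
  rewrite ifT //; apply/and3P; split=> //=; first by rewrite X1.
  by move: Y2; rewrite ltnS leq_min => /andP[].
by case: ifP => // _; exact: colouring_weight_ge0.
Qed.

Lemma objective_le_turan_number (S : finType) (H : {set {set S}}) (n : nat) :
  (forall col : S -> colour N, exists2 e, e \in H & ~~ well_coloured q col e) ->
  objective q N.+1 a b c * 'C(n, q.+1)%:R <= (turan_number q.+1 n H)%:R.
Proof.
move=> noncol.
pose G (f : {ffun 'I_n -> colour N}) :=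
  [set e : {set 'I_n} | (#|e| == q.+1) && well_coloured q f e].
(* A copy [g] of [H] in [G f] would make every edge of [H] well coloured by [f \o g], against
   [noncol]. *)
have Gle f : (#|G f| <= turan_number q.+1 n H)%N.
  apply: turan_number_ge.
    by apply/forall_inP => e; rewrite inE => /andP[].
  apply/existsP => -[g /andP[/injectiveP ginj /fintype.subsetP sub]].
  have [e eH /negP[]] := noncol (f \o g).
  have := sub _ (imset_f (fun e : {set S} => g @: e) eH).
  rewrite inE => /andP[_].
  have cardE x : #|[set y in g @: e | f y == x]| = #|[set y in e | (f \o g) y == x]|.
    rewrite -[RHS](card_imset _ ginj); apply: eq_card => y; rewrite inE.
    apply/andP/imsetP => [[/imsetP[z ze ->] fz]|[z]].
      by exists z => //; rewrite inE ze.
    by rewrite inE => /andP[ze fz] ->; rewrite imset_f.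
  rewrite /well_coloured !cardE => /and3P[-> -> /forallP inj] /=.
  by apply/forallP => k; rewrite -cardE.
(* Since the weights sum to 1, the bound on each [#|G f|] bounds the expected number of edges, which
   is then summed edge by edge. *)
have -> : (turan_number q.+1 n H)%:R =
    \sum_(f : {ffun 'I_n -> colour N})
       colouring_weight a b c f * (turan_number q.+1 n H)%:R :> R.
  by rewrite -mulr_suml sum_colouring_weight // mul1r.
apply: (@le_trans _ _ (\sum_(f : {ffun 'I_n -> colour N})
       colouring_weight a b c f * #|G f|%:R)); last first.
  apply: ler_sum => f _; apply: ler_wpM2l; last by rewrite ler_nat.
  exact: colouring_weight_ge0.
under eq_bigr => f _ do rewrite mulr_natr -sumr_const.
rewrite (exchange_big_dep (fun e : {set 'I_n} => #|e| == q.+1)) /=; last first.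
  by move=> f e _; rewrite inE => /andP[].
rewrite -[n in 'C(n, _)]card_ord -card_draws mulr_natr -sumr_const.
rewrite [leLHS](eq_bigl (fun e : {set 'I_n} => #|e| == q.+1)) /=; last first.
  by move=> e; rewrite inE.
apply: ler_sum => e /eqP ecard.
rewrite (eq_bigl (fun f : {ffun 'I_n -> colour N} => well_coloured q f e)).
  exact: objective_le_well_coloured_weight.
by move=> f; rewrite inE ecard eqxx.
Qed.

Lemma objective_le_turan_density (S : finType) (H : {set {set S}}) :
  (forall col : S -> colour N, exists2 e, e \in H & ~~ well_coloured q col e) ->
  objective q N.+1 a b c <= turan_density R q.+1 H.
Proof.
move=> noncol; apply: turan_density_ge.
  by have [e eH _] := noncol (fun=> None); apply/set0Pn; exists e.
by move=> n; exact: objective_le_turan_number.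
Qed.

End ColouredTuranBound.

(** * Arcs and blocking sets in projective planes *)

Section ProjectivePlane.
Local Open Scope nat_scope.
Variables (T : finType) (L : {set {set T}}) (q : nat).
Hypothesis join_unique : forall x y : T, x != y ->
  exists e, forall f, [&& f \in L, x \in f & y \in f] = (f == e).
Hypothesis card_line : forall e, e \in L -> #|e| = q.+1.
Hypothesis card_plane : #|T| = q ^ 2 + q + 1.
Hypothesis lines_meet : forall e f, e \in L -> f \in L ->
  e :&: f != finset.set0.

Implicit Types (e f : {set T}) (x y : T) (A : {set T}) (B : {set {set T}}).

Definition lines_at B x := [set e in B | x \in e].

Lemma sum_card_setI B A :
  \sum_(e in B) #|e :&: A| = \sum_(x in A) #|lines_at B x|.
Proof.
under eq_bigr => e _ do rewrite -sum1_card.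
rewrite (exchange_big_dep (fun x => x \in A)) /=; last first.
  by move=> e x _; rewrite inE => /andP[].
apply: eq_bigr => x xA; rewrite sum1_card -[in RHS]cardsE.
by apply: eq_card => e; rewrite [LHS]unfold_in !inE xA andbT.
Qed.

(** Each point of [A] lies on exactly one line through [x]. *)
Lemma sum_lines_at x A : x \notin A ->
  \sum_(e in lines_at L x) #|e :&: A| = #|A|.
Proof.
move=> xA; rewrite sum_card_setI -sum1_card; apply: eq_bigr => y yA.
have [|e eE] := @join_unique x y; first by apply: contraNneq xA => ->.
rewrite -(cards1 e); apply: eq_card => f; rewrite !inE -eE.
by rewrite -andbA.
Qed.

Hypothesis q_gt0 : 0 < q.

(** The lines through [x] partition the other [q ^ 2 + q] points into classes of size [q]. *)
Lemma card_lines_at x : #|lines_at L x| = q.+1.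
Proof.
have := @sum_lines_at x [set~ x]; rewrite !inE eqxx => /(_ isT).
rewrite (eq_bigr (fun=> q)); last first.
  move=> e; rewrite inE => /andP[eL xe].
  have := cardsD1 x e; rewrite xe (card_line eL) -finset.setDE.
  by move=> [].
rewrite sum_nat_const cardsC1 card_plane addn1 /= => E; apply/eqP.
by rewrite -(eqn_pmul2r q_gt0) E mulSn -mulnn addnC.
Qed.

Lemma card_lines : #|L| = q ^ 2 + q + 1.
Proof.
have := sum_card_setI L [set: T].
rewrite (eq_bigr (fun=> q.+1)); last first.
  by move=> e eL; rewrite finset.setIT card_line.
rewrite [RHS](eq_bigr (fun=> q.+1)); last by move=> x _; exact: card_lines_at.
by rewrite !sum_nat_const cardsT card_plane => /eqP; rewrite eqn_mul2r => /eqP.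
Qed.

Lemma line_unique x y e f : x != y -> e \in L -> f \in L ->
  x \in e -> y \in e -> x \in f -> y \in f -> e = f.
Proof.
move=> /join_unique[g gE] eL fL xe ye xf yf.
have /eqP-> : e == g by rewrite -gE eL xe.
by apply/esym/eqP; rewrite -gE fL xf.
Qed.

Lemma card_setI_lines e f : e \in L -> f \in L -> e != f -> #|e :&: f| = 1.
Proof.
move=> eL fL ef; apply/eqP; rewrite eqn_leq card_gt0 lines_meet // andbT.
apply/card_le1_eqP => x y; rewrite !inE => /andP[xe xf] /andP[ye yf].
apply: contraNeq ef => xy; apply/eqP; exact: line_unique xy eL fL ye xe yf xf.
Qed.

(** * Line counts for an arc *)

Section Arc.
Variable K : {set T}.
Hypothesis arcK : forall e, e \in L -> #|e :&: K| <= 2.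

Definition external := [set e in L | #|e :&: K| == 0].
Definition tangent := [set e in L | #|e :&: K| == 1].
Definition secant := [set e in L | #|e :&: K| == 2].

(** Applied to all lines or to a pencil, with [F n] equal to 1, [n] or [n * n.-1], this yields the
    standard equations of an arc. *)
Lemma sum_arc_lines B (F : nat -> nat) : B \subset L ->
  \sum_(e in B) F #|e :&: K| = #|B :&: external| * F 0 + #|B :&: tangent| * F 1
     + #|B :&: secant| * F 2.
Proof.
move=> BL; rewrite -!sum_nat_const [in RHS]big_mkcond /=.
rewrite [X in _ + X + _]big_mkcond [X in _ + _ + X]big_mkcond /=.
rewrite -!big_split big_mkcond /=; apply: eq_bigr => e _; rewrite !inE.
case: (boolP (e \in B)) => //= /(fintype.subsetP BL) eL; rewrite eL /=.
by have := arcK eL; case: #|_| => [|[|[|n]]] //=; rewrite !addn0.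
Qed.

(** Counting lines, incidences with [K] and ordered pairs of points of [K] gives three linear
    equations, from which tangents and secants are eliminated. *)
Lemma card_external :
  2 * #|external| + 2 * #|K| * q.+1 = 2 * (q ^ 2 + q + 1) + #|K| * #|K|.-1.
Proof.
have sub (P : pred {set T}) : L :&: [set e in L | P e] = [set e in L | P e].
  by apply/setP => e; rewrite !inE andbA andbb.
have := sum_arc_lines (fun=> 1) (fintype.subxx L); rewrite sum1_card card_lines.
have := sum_arc_lines id (fintype.subxx L); rewrite sum_card_setI.
rewrite (eq_bigr (fun=> q.+1)); last by move=> x _; exact: card_lines_at.
rewrite sum_nat_const.
have := sum_arc_lines (fun n => n * n.-1) (fintype.subxx L).
(* Ordered pairs of distinct points of [K], each counted on the line that joins them. *)
have -> : \sum_(e in L) #|e :&: K| * #|e :&: K|.-1 = #|K| * #|K|.-1.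
  under eq_bigr => e _ do rewrite -sum_nat_const.
  rewrite (exchange_big_dep (fun x => x \in K)) /=; last first.
    by move=> e x _; rewrite inE => /andP[].
  rewrite -sum_nat_const; apply: eq_bigr => x xK.
  have := @sum_lines_at x (K :\ x); rewrite !inE eqxx => /(_ isT).
  have -> : #|K :\ x| = #|K|.-1 by rewrite [in RHS](cardsD1 x K) xK.
  move=> <-; rewrite [RHS](eq_bigl (fun e => (e \in L) && (x \in e :&: K))).
    apply: eq_bigr => e /andP[_ xeK]; rewrite (cardsD1 x) xeK /=.
    by rewrite finset.setDE -finset.setIA -finset.setDE.
  by move=> e; rewrite !inE xK andbT.
rewrite !sub -/external -/tangent -/secant; lia.
Qed.

(** The same elimination in the pencil of a point off [K], whose lines partition [K]. *)
Lemma card_external_at x : x \notin K ->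
  #|lines_at external x| + #|K| = q.+1 + #|lines_at secant x|
  /\ #|lines_at tangent x| + 2 * #|lines_at secant x| = #|K|.
Proof.
move=> xK.
have sub (P : pred {set T}) :
    lines_at L x :&: [set e in L | P e] = lines_at [set e in L | P e] x.
  by apply/setP => e; rewrite !inE; case: (e \in L); rewrite ?andbF //= andbC.
have Bx : lines_at L x \subset L by apply/fintype.subsetP => e; rewrite inE => /andP[].
have := sum_arc_lines (fun=> 1) Bx; rewrite sum1_card card_lines_at.
have := sum_arc_lines id Bx; rewrite sum_lines_at //.
rewrite !sub -/external -/tangent -/secant; lia.
Qed.

(** Each of the [q.+1] lines through a point of [K] carries at most one further point of [K]. *)
Lemma card_arc_le : #|K| <= q + 2.
Proof.
have [->|/set0Pn[x xK]] := eqVneq K finset.set0; first by rewrite cards0.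
have := @sum_lines_at x (K :\ x); rewrite !inE eqxx => /(_ isT) E.
rewrite (cardsD1 x K) xK -E.
have : \sum_(e in lines_at L x) #|e :&: (K :\ x)| <= \sum_(e in lines_at L x) 1.
  apply: leq_sum => e; rewrite inE => /andP[eL xe].
  have := arcK eL; rewrite (cardsD1 x) !inE xe xK /=.
  by rewrite finset.setDE -finset.setIA -finset.setDE.
by rewrite sum1_card card_lines_at; lia.
Qed.

(** * Sets blocking the external lines *)

Section Blocking.
Variable Q : {set T}.
Hypothesis QK : [disjoint Q & K].
Hypothesis blockQ : forall e, e \in external -> 0 < #|e :&: Q|.

Lemma external_le_sum : #|external| <= \sum_(x in Q) #|lines_at external x|.
Proof. by rewrite -sum_card_setI -sum1_card; exact: leq_sum. Qed.

Lemma external_at_le x : x \in Q ->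
  2 * #|lines_at external x| + #|K| <= 2 * q.+1.
Proof.
by move=> xQ; have [] := card_external_at (negbT (disjointFr QK xQ)); lia.
Qed.

(* The slack [#|Q| * D - #|external|] counts missing external lines at the points
   of [Q] and repeated blockings; each unit of it spoils at most two points. *)
Lemma good_blocking_point D :
  (forall x, x \in Q -> #|lines_at external x| <= D) ->
  2 * (#|Q| * D) < #|Q| + 2 * #|external| ->
  exists2 x, x \in Q & #|lines_at external x| = D /\
    forall e, e \in lines_at external x -> #|e :&: Q| = 1.
Proof.
move=> Dle lt.
pose W := [set e in external | 1 < #|e :&: Q|].
have [/exists_inP[x xQ /andP[/eqP xD /eqP xW]]|/exists_inPn nogood] :=
    boolP [exists x in Q, (#|lines_at external x| == D) && (#|lines_at W x| == 0)].
  exists x => //; split=> // e; rewrite inE => /andP[eE xe]; apply/eqP.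
  rewrite eqn_leq blockQ // andbT leqNgt; apply/negP => eW.
  have : e \in lines_at W x by rewrite inE xe andbT inE eE.
  by move/eqP: xW; rewrite cards_eq0 => /eqP->; rewrite finset.in_set0.
(* Without a good point, each point of [Q] misses an external line or lies on a line of [W], so it
   contributes at least 1. *)
have le1 : #|Q| <= \sum_(x in Q) ((D - #|lines_at external x|) + #|lines_at W x|).
  rewrite -sum1_card; apply: leq_sum => x xQ.
  by have := nogood _ xQ; have := Dle _ xQ; rewrite negb_and; lia.
rewrite big_split /= -sum_card_setI in le1.
have E1 : \sum_(x in Q) (D - #|lines_at external x|)
    + \sum_(e in external) #|e :&: Q| = #|Q| * D.
  rewrite sum_card_setI -big_split /= -sum_nat_const.
  by apply: eq_bigr => x xQ; rewrite subnK ?Dle.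
(* An external line with [m] points of [Q] satisfies [m + 2 <= 2 * m] if it is in [W], and
   [2 <= 2 * m] otherwise. *)
have E2 : \sum_(e in W) #|e :&: Q| + 2 * #|external|
    <= 2 * \sum_(e in external) #|e :&: Q|.
  rewrite -sum1_card !big_distrr /= [X in _ + X <= _](big_setID W) /= [X in _ <= X](big_setID W) /=.
  have -> : external :&: W = W.
    by apply/setP => e; rewrite !inE andbA andbb.
  rewrite addnA -big_split /= leq_add //; apply: leq_sum => e.
    by rewrite inE => /andP[_ e2]; rewrite muln1 mul2n -addnn leq_add2l.
  by rewrite inE => /andP[_ eE]; rewrite leq_mul2l /= blockQ.
exfalso; move: le1 E1 E2 lt; move: (\sum_(e in W) _) (\sum_(e in external) _).
move: (\sum_(x in Q) _) (#|Q| * D) #|Q| #|external| => a p m E w u.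
by clear; lia.
Qed.

(* Every external line meets [l] outside [K], and those meeting it outside [Q]
   are blocked by points of [Q] off [l]. *)
Lemma secant_blocking_points D l : l \in secant ->
  (forall x, x \in Q -> #|lines_at external x| <= D) ->
  #|external| <= #|l :&: Q| * D + (q.-1 - #|l :&: Q|) * (#|Q| - #|l :&: Q|)
  /\ (#|l :&: Q| < q.-1 -> q + 2 + #|l :&: Q| <= #|K| + #|Q|).
Proof.
move=> lsec Dle; have := lsec; rewrite inE => /andP[lL /eqP lK].
have yQ : #|l :&: Q| <= #|Q| by rewrite subset_leq_card ?finset.subsetIr.
(* The external lines through [x] differ from [l], so they are blocked by distinct points of [Q] off
   [l]. *)
have free x : x \in l -> x \notin Q ->
    #|lines_at external x| <= #|Q| - #|l :&: Q|.
  move=> xl xQ; rewrite -(sum_lines_at xQ) (bigD1 l) /=; last by rewrite inE lL.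
  rewrite addKn -sum1_card big_mkcond [X in _ <= X]big_mkcond /=.
  apply: leq_sum => e _; rewrite !inE; case: ifP => // /andP[/andP[eL e0] xe].
  rewrite eL xe /= ifT; first by apply: blockQ; rewrite inE eL.
  by apply: contraTneq e0 => ->; rewrite lK.
have splitl : #|l :\: Q :\: K| = q.-1 - #|l :&: Q|.
  have := cardsID Q l; have := cardsID K (l :\: Q); rewrite (card_line lL).
  have -> : (l :\: Q) :&: K = l :&: K.
    apply/setP => x; rewrite !inE; case: (boolP (x \in K)) => xK; rewrite ?andbF //.
    by rewrite (disjointFl QK xK).
  rewrite lK; lia.
split.
  have -> : #|external| = \sum_(x in l) #|lines_at external x|.
    rewrite -sum_card_setI -sum1_card; apply: eq_bigr => e.
    rewrite inE => /andP[eL e0]; rewrite card_setI_lines //.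
    by apply: contraTneq e0 => ->; rewrite lK.
  rewrite (big_setID Q) /= leq_add //.
    rewrite -sum_nat_const; apply: leq_sum => x; rewrite inE => /andP[_].
    exact: Dle.
  rewrite (big_setID K) /= -splitl -[X in _ <= X]add0n leq_add //.
    rewrite leqn0 sum_nat_eq0; apply/forall_inP => x; rewrite inE => /andP[_ xK].
    rewrite cards_eq0; apply/eqP/setP => e; rewrite !inE.
    apply/negP => /andP[/andP[_]]; rewrite cards_eq0 => /eqP/setP/(_ x).
    by rewrite !inE xK andbT => ->.
  rewrite -sum_nat_const; apply: leq_sum => x.
  rewrite !inE => /and3P[_ xQ xl]; exact: free.
(* If [l] has a point outside [K] and [Q], the secant [l] through it forces at least [q + 2 - #|K|]
   external lines there, to be compared with [free]. *)
rewrite -subn_gt0 -splitl card_gt0 => /set0Pn[x]; rewrite !inE => /and3P[xK xQ xl].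
have [+ _] := card_external_at xK; have := free _ xl xQ.
have : 0 < #|lines_at secant x|.
  by rewrite card_gt0; apply/set0Pn; exists l; rewrite inE lsec.
lia.
Qed.

(** Here [D] is q + 1 - k/2, so a good point lies on k/2 secants and no tangent. Its external lines
    meet [Q] nowhere else, so the rest of [Q] lies on these secants, with at most [s.-1] points on
    each. *)
Lemma blocking_contradiction D s :
  2 * D + #|K| = 2 * q.+1 ->
  2 * (#|Q| * D) < #|Q| + 2 * #|external| ->
  (forall l, l \in secant -> #|l :&: Q| <= s) ->
  #|K| * s.-1 < 2 * #|Q|.-1 -> False.
Proof.
move=> Ddef lt sP.
have Dle x : x \in Q -> #|lines_at external x| <= D.
  by move/external_at_le; lia.
have [x xQ [xD xE]] := good_blocking_point Dle lt.
have xK := negbT (disjointFr QK xQ).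
have [E1 E2] := card_external_at xK.
have xT : #|lines_at tangent x| = 0 by lia.
have := @sum_lines_at x (Q :\ x); rewrite !inE eqxx => /(_ isT).
have -> : #|Q :\ x| = #|Q|.-1 by rewrite [in RHS](cardsD1 x Q) xQ.
move=> sumE.
suff : #|Q|.-1 <= \sum_(e in lines_at secant x) s.-1.
  rewrite sum_nat_const; nia.
rewrite -sumE big_mkcond [X in _ <= X]big_mkcond /=; apply: leq_sum => e _.
case: ifP => // eLx; have := eLx; rewrite inE => /andP[eL xe].
have card1 : #|e :&: Q| = #|e :&: (Q :\ x)|.+1.
  rewrite (cardsD1 x) !inE xe xQ /=.
  by rewrite finset.setDE -finset.setIA -finset.setDE.
case: ifPn => [|nsec].
  by rewrite inE => /andP[/sP]; lia.
have eE : e \in lines_at external x.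
  have ntan : e \notin lines_at tangent x.
    by move/eqP: xT; rewrite cards_eq0 => /eqP->; rewrite finset.in_set0.
  move: nsec ntan; rewrite !inE eL xe !andbT /=.
  by have := arcK eL; case: #|_| => [|[|[|]]].
by have := xE _ eE; rewrite card1 => -[->].
Qed.

End Blocking.

Lemma blocking_set_bound (Q : {set T}) :
  q \in [:: 3; 4; 5; 7; 8] -> [disjoint Q & K] ->
  (forall e, e \in external -> 0 < #|e :&: Q|) -> q.-1 <= #|Q|.
Proof.
move=> q5 QK blockQ; rewrite leqNgt; apply/negP => Qq.
have k_le := card_arc_le.
have ext := card_external.
have sumQ := external_le_sum blockQ.
have bound D : 2 * q.+1 < 2 * D.+1 + #|K| -> #|external| <= #|Q| * D.
  move=> Dk; apply: leq_trans sumQ _; rewrite -sum_nat_const; apply: leq_sum => x xQ.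
  have := external_at_le QK xQ; lia.
have except D s : 2 * D + #|K| = 2 * q.+1 ->
  2 * (#|Q| * D) < #|Q| + 2 * #|external| ->
  (forall y : nat, s < y -> 
    #|external| <= y * D + (q.-1 - y) * (#|Q| - y) ->
    (y < q.-1 -> q + 2 + y <= #|K| + #|Q|) -> y <= #|Q| -> False) ->
  #|K| * s.-1 < 2 * #|Q|.-1 -> False.
  move=> Ddef lt sP; apply: (blocking_contradiction QK blockQ Ddef lt) => l lsec.
  have Dle x : x \in Q -> #|lines_at external x| <= D.
    by move/(external_at_le QK); lia.
  have [A1 A2] := secant_blocking_points QK blockQ lsec Dle.
  rewrite leqNgt; apply/negP => /sP; apply=> //.
  by rewrite subset_leq_card ?finset.subsetIr.
have {bound sumQ} bound := bound (q.+1 - uphalf #|K|).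
(* As k is at most [q + 2], finitely many pairs (q, k) remain, and the count of external lines
   refutes all but three. In these [Q] has exactly [q - 2] points. *)
have cases : q \in [:: 3; 4; 5; 7; 8] -> q - 1 - 1 >= #|Q|
   -> #|external| <= #|Q| * (q.+1 - uphalf #|K|) -> 
   [\/ [/\ q = 7, #|K| = 6, #|Q| = 5 & #|external| = 24],
       [/\ q = 8, #|K| = 8, #|Q| = 6 & #|external| = 29]
     | [/\ q = 8, #|K| = 6, #|Q| = 6 & #|external| = 34]].
  move: k_le ext; clear; move: q #|K| #|Q| #|external| => q' k t E kq ext.
  rewrite !inE => /or4P[/eqP qE|/eqP qE|/eqP qE|/orP[] /eqP qE];
    move: kq ext; rewrite {}qE;
    move: k => [|[|[|[|[|[|[|[|[|[|[|k]]]]]]]]]]] //= kq ext tq Et;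
    first [exfalso; lia | constructor 1; split=> //; lia
          | constructor 2; split=> //; lia | constructor 3; split=> //; lia].
have [||[qE kE tE eE]|[qE kE tE eE]|[qE kE tE eE]] := cases q5.
- by lia.
- by apply: bound; move: k_le; rewrite uphalf_half; have := odd_double_half #|K|; lia.
(* In each of the three cases the first secant inequality excludes [s < y < #|Q|], and the second
   excludes [y = #|Q|]. *)
- apply: (except 5 1); rewrite ?qE ?kE ?tE ?eE // => y.
  by case: y => [|[|[|[|[|[|y]]]]]]; lia.
- apply: (except 5 2); rewrite ?qE ?kE ?tE ?eE // => y.
  by case: y => [|[|[|[|[|[|[|y]]]]]]]; lia.
apply: (except 6 1); rewrite ?qE ?kE ?tE ?eE // => y.
by case: y => [|[|[|[|[|[|[|y]]]]]]]; lia.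
Qed.

End Arc.
End ProjectivePlane.

(** * The plane over a finite field *)

Section PG2Plane.
Variable F : finFieldType.
Local Notation point := (pg_point F).

Lemma rank_point (p : point) : \rank (sval p) = 1%N.
Proof. by case: p => A /= /andP[/eqP]. Qed.

Lemma eq_pointP (p r : point) : reflect (p = r) (sval p == sval r)%MS.
Proof.
apply: (iffP idP) => [|->]; last exact/eqmxP.
move=> /eqmxP/eq_genmx; case: p r => [A pA] [B pB] /= AB; apply/val_inj => /=.
by case/andP: pA => _ /eqP <-; case/andP: pB => _ /eqP <-.
Qed.

Lemma eq_point_sub (p r : point) : (sval p <= sval r)%MS -> p = r.
Proof.
by move=> pr; apply/eq_pointP; rewrite -(geq_leqif (mxrank_leqif_eq pr)) !rank_point.
Qed.

Definition point_of_row (v : 'rV[F]_3) (v0 : v != 0) : point.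
Proof.
exists <<v>>%MS.
by rewrite genmx_id eqxx andbT genmxE rank_rV v0.
Defined.

Lemma point_of_row_sub (v : 'rV[F]_3) (v0 : v != 0) (M : 'M[F]_3) :
  (sval (point_of_row v0) <= M)%MS = (v <= M)%MS.
Proof. by rewrite /= genmxE. Qed.

(** Each nonzero vector of the subspace spans one point, and each point contains [#|F| - 1] nonzero
    vectors. *)
Lemma card_points_in (M : 'M[F]_3) :
  (#|[set p : point | (sval p <= M)%MS]| * (#|F| - 1) = #|F| ^ \rank M - 1)%N.
Proof.
have card_nz (A : 'M[F]_3) :
    #|[set v : 'rV[F]_3 | (v <= A)%MS & v != 0]| = (#|F| ^ \rank A - 1)%N.
  rewrite -card_rowg (cardsD1 0 (rowg A)) inE sub0mx add1n subn1 /=.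
  by apply: eq_card => v; rewrite !inE andbC.
rewrite -card_nz -sum_nat_const -[RHS]sum1_card.
rewrite (eq_bigr (fun p : point =>
  (\sum_(v : 'rV[F]_3 | (v <= sval p)%MS && (v != 0%R)) 1)%N)).
  rewrite (exchange_big_dep (fun v : 'rV[F]_3 => (v <= M)%MS && (v != 0))) /=.
    rewrite [RHS](eq_bigl (fun v : 'rV[F]_3 => (v <= M)%MS && (v != 0))).
      apply: eq_bigr => v /andP[vM v0].
      rewrite (big_pred1 (point_of_row v0)) // => p /=.
      rewrite inE v0 andbT; apply/andP/eqP => [[pM vp]|->].
        by apply/esym/eq_point_sub; rewrite point_of_row_sub.
      by rewrite /= !genmxE vM submx_refl.
    by move=> v; rewrite inE.
  by move=> p v; rewrite inE => pM /andP[vp ->]; rewrite (submx_trans vp pM).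
move=> p _; rewrite sum1_card.
by have := card_nz (sval p); rewrite rank_point expn1 => <-; apply: eq_card => v; rewrite [RHS]unfold_in inE.
Qed.

Lemma PG2_card_line e : e \in PG2 F -> #|e| = #|F|.+1.
Proof.
move=> /imsetP[M]; rewrite inE => /eqP rM ->; rewrite /line_of.
have := card_points_in M; rewrite rM => E.
have F1 := card_finNzRing_gt1 F.
apply/eqP; rewrite -(@eqn_pmul2r (#|F| - 1)) ?E ?subn_gt0 //.
by apply/eqP; nia.
Qed.

Lemma PG2_card_plane : #|point| = (#|F| ^ 2 + #|F| + 1)%N.
Proof.
have := card_points_in 1%:M; rewrite mxrank1.
have -> : [set p : point | (sval p <= (1%:M : 'M[F]_3))%MS] = [set: point].
  by apply/setP => p; rewrite !inE submx1.
rewrite cardsT => E; have F1 := card_finNzRing_gt1 F.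
apply/eqP; rewrite -(@eqn_pmul2r (#|F| - 1)) ?E ?subn_gt0 //.
by apply/eqP; rewrite !expnS expn0; nia.
Qed.

Lemma PG2_lines_meet e f : e \in PG2 F -> f \in PG2 F ->
  e :&: f != finset.set0.
Proof.
move=> /imsetP[A]; rewrite inE => /eqP rA -> /imsetP[B]; rewrite inE => /eqP rB ->.
have : (0 < \rank (A :&: B)%MS)%N.
  by have := mxrank_sum_cap A B; have := rank_leq_row (A + B)%MS; lia.
rewrite lt0n mxrank_eq0 => /rowV0Pn[v vAB v0].
apply/set0Pn; exists (point_of_row v0).
by move: vAB; rewrite sub_capmx !inE !point_of_row_sub.
Qed.

Lemma PG2_join_unique (p r : point) : p != r ->
  exists e, forall f, [&& f \in PG2 F, p \in f & r \in f] = (f == e).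
Proof.
move=> pr; pose M := (sval p + sval r)%MS.
have rM : \rank M = 2%N.
  have := mxrank_sum_cap (sval p) (sval r); rewrite !rank_point -/M.
  suff -> : \rank (sval p :&: sval r)%MS = 0%N by rewrite addn0.
  apply/eqP; apply: contraNT pr => r0; apply/eqP/eq_point_sub.
  apply: submx_trans (capmxSr (sval p) (sval r)).
  rewrite -(geq_leqif (mxrank_leqif_sup (capmxSl (sval p) (sval r)))).
  by rewrite rank_point lt0n.
exists (line_of M) => f; apply/and3P/eqP => [[/imsetP[A] + -> +]|->].
  rewrite !inE => /eqP rA pA rA'.
  have MA : (M <= A)%MS by rewrite addsmx_sub pA.
  have : (M == A)%MS by rewrite -(geq_leqif (mxrank_leqif_eq MA)) rM rA.
  by move=> /eqmxP E; apply/setP => x; rewrite !inE E.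
split; first by apply/imsetP; exists M => //; rewrite inE rM.
  by rewrite inE addsmxSl.
by rewrite inE addsmxSr.
Qed.

Lemma pg_arc_le2 (K : {set point}) : pg_arc K ->
  forall e, e \in PG2 F -> (#|e :&: K| <= 2)%N.
Proof.
move=> /forallP arcK e eL; rewrite leqNgt; apply/negP => gt2.
have : (0 < #|[set S : {set point} | (S \subset e :&: K) & #|S| == 3%N]|)%N.
  by rewrite cards_draws bin_gt0.
move=> /card_gt0P[S]; rewrite inE finset.subsetI => /andP[/andP[Se SK] S3].
have /implyP/(_ _)/negP[] := arcK S; first by rewrite SK S3.
by apply/exists_inP; exists e.
Qed.

Lemma le2_pg_arc (K : {set point}) :
  (forall e, e \in PG2 F -> (#|e :&: K| <= 2)%N) -> pg_arc K.
Proof.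
move=> K2; apply/forallP => S; apply/implyP => /andP[SK /eqP S3].
apply/exists_inP => -[e eL Se]; have := K2 e eL.
apply/negP; rewrite -ltnNge -S3 subset_leq_card // finset.subsetI Se.
exact: SK.
Qed.

(** An arc extends to a complete one, and enlarging [K] only shrinks the complement of [K :|: Q]. *)
Lemma M_arc_le (K Q : {set point}) :
  pg_arc K -> leaves_no_line K Q -> (M_arc F <= #|Q|)%N.
Proof.
move=> arcK KQ; have [K' maxK' KK'] := maxset_exists arcK.
have K'Q : leaves_no_line K' Q.
  apply/forall_inP => e eL; apply: contra (forall_inP KQ e eL) => /fintype.subset_trans.
  by apply; rewrite finset.setCS finset.setSU.
have mK' : (m_arc K' <= #|Q|)%N.
  rewrite /m_arc; case: ex_minnP => m _; apply.
  by apply/existsP; exists Q; rewrite K'Q eqxx.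
apply: leq_trans mK'; rewrite /M_arc; case: ex_minnP => m _; apply.
by apply/existsP; exists K'; rewrite eqxx andbT.
Qed.

Lemma M_arc_witness :
  exists K Q : {set point}, [/\ pg_arc K, leaves_no_line K Q & #|Q| = M_arc F].
Proof.
rewrite /M_arc; case: ex_minnP => M /existsP[K /andP[maxK /eqP mK]] _.
move: mK; rewrite /m_arc; case: ex_minnP => m /existsP[Q /andP[KQ /eqP Qm]] _ mM.
by exists K, Q; rewrite KQ Qm mM; split=> //; exact: (maxsetp maxK).
Qed.

Lemma PG2_not_well_coloured (N : nat) : (N < M_arc F)%N ->
  forall col : point -> colour N,
    exists2 e, e \in PG2 F & ~~ well_coloured #|F| col e.
Proof.
move=> NM col; apply/exists_inP; apply: contraLR NM; rewrite negb_exists_in.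
move=> /forall_inP well; rewrite -leqNgt.
have {}well e : e \in PG2 F -> well_coloured #|F| col e.
  by move=> eL; have := well e eL; rewrite negbK.
pose K := [set p | col p == Some None].
pose Q := [set p | if col p is Some (Some _) then true else false].
have arcK : pg_arc K.
  apply: le2_pg_arc => e eL; have /and3P[_ + _] := well e eL.
  by apply: leq_trans; rewrite subset_leq_card //; apply/fintype.subsetP => p; rewrite !inE.
(* A line avoiding B and all C_k would have its [#|F|.+1] points in A, one more than allowed. *)
have KQ : leaves_no_line K Q.
  apply/forall_inP => e eL; have /and3P[/andP[_ le] _ _] := well e eL.
  apply: contraL le => /fintype.subsetP sub; rewrite -ltnNge.
  rewrite -(PG2_card_line eL) subset_leq_card //; apply/fintype.subsetP => p pe.
  rewrite inE pe /=; have := sub p pe; rewrite !inE.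
  by case: (col p) => [[]|].
apply: leq_trans (M_arc_le arcK KQ) _.
pose k p : option 'I_N := if col p is Some c then c else None.
(* Two points of the same class C_k would lie together on their joining line. *)
have kinj : {in Q &, injective k}.
  move=> p r; rewrite !inE /k.
  case cp: (col p) => [[i|]|] // _; case cr: (col r) => [[j|]|] // _ [ij].
  apply/eqP; apply: contraT => pr; have [e eE] := PG2_join_unique pr.
  have /and3P[eL pe re] : [&& e \in PG2 F, p \in e & r \in e] by rewrite eE.
  have /and3P[_ _ /forallP/(_ i)] := well e eL.
  rewrite leqNgt => /negP[]; rewrite (cardsD1 p) (cardsD1 r) !inE.
  by rewrite pe re cp cr ij eqxx eq_sym pr.
rewrite -(card_in_imset kinj) -[N in (_ <= N)%N]card_ord.
rewrite -(card_imset 'I_N (@Some_inj _)); apply: subset_leq_card.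
apply/fintype.subsetP => _ /imsetP[p + ->]; rewrite inE /k.
by case: (col p) => [[i|]|] // _; rewrite imset_f.
Qed.

Lemma M_arc_ge : #|F| \in [:: 3; 4; 5; 7; 8]%N -> (#|F|.-1 <= M_arc F)%N.
Proof.
move=> F5; have [K [Q [arcK KQ <-]]] := M_arc_witness.
(* [Q] may meet [K], but points of [K] are on no external line, so [Q :\: K] still blocks. *)
have QD : (#|Q :\: K| <= #|Q|)%N by rewrite subset_leq_card // finset.subsetDl.
apply: leq_trans QD.
have F0 : (0 < #|F|)%N := ltnW (card_finNzRing_gt1 F).
apply: (blocking_set_bound PG2_join_unique PG2_card_line PG2_card_plane
  PG2_lines_meet F0 (pg_arc_le2 arcK) F5).
  by rewrite disjoint_sym; apply/pred0P => p /=; rewrite inE; case: (p \in K).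
move=> e; rewrite inE => /andP[eL]; rewrite cards_eq0 => /eqP eK.
rewrite card_gt0; apply: contra (forall_inP KQ e eL) => /eqP eQ.
apply/fintype.subsetP => p pe; rewrite !inE negb_or.
have pK : p \notin K.
  by apply/negP => pK; move/setP/(_ p): eK; rewrite !inE pe pK.
rewrite pK; apply/negP => pQ.
by move/setP/(_ p): eQ; rewrite !inE pe pK pQ.
Qed.

End PG2Plane.

(** * The maximum and its numerical values *)

Section ObjectiveMaximum.
Local Open Scope classical_set_scope.
Local Open Scope ring_scope.

Lemma objective_continuous (R : realType) (q M : nat) :
  continuous (fun x : R * R * R => objective q M x.1.1 x.1.2 x.2).
Proof.
move=> x; rewrite /objective; apply: cvgM; first exact: cvg_cst.
have ctsX (f : R * R * R -> R) n : f y @[y --> x] --> f x ->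
    (f y) ^+ n @[y --> x] --> (f x) ^+ n.
  move=> fx; elim: n => [|n IHn]; first by rewrite expr0; exact: cvg_cst.
  rewrite exprS; under eq_cvg do rewrite exprS.
  exact: cvgM.
have c1 : y.1.1 @[y --> x] --> x.1.1.
  by apply: (cvg_comp _ _ (cvg_fst (G := _))); exact: cvg_fst.
have c2 : y.1.2 @[y --> x] --> x.1.2.
  by apply: cvg_comp; [exact: cvg_fst|exact: cvg_snd].
have c3 : y.2 @[y --> x] --> x.2 by exact: cvg_snd.
apply: cvg_big => [|i _]; first exact: add_continuous.
apply: cvg_big => [|j _]; first exact: add_continuous.
by do ![apply: cvgM; last exact: ctsX]; exact: cvg_cst.
Qed.

Lemma objective_values_max (R : realType) (q M : nat) :
  exists m : R, is_max (objective_values R q M) m.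
Proof.
pose I : set R := [set x | 0 <= x <= 1].
have cptI : compact I by rewrite /I -set_itvcc; exact: segment_compact.
(* A compact slice of the unit cube. For [M >= 2] it is the whole feasible region, as the
   coefficient of [c] is then at least 1. *)
pose S := (I `*` I `*` I `&`
  (fun x : R * R * R => x.1.1 + x.1.2 + (M - 1)%:R * x.2) @^-1` [set 1%R])%classic.
have SP (a b c : R) : S (a, b, c) <-> [/\ 0 <= a <= 1, 0 <= b <= 1, 0 <= c <= 1
   & a + b + (M - 1)%:R * c = 1].
  split; first by move=> [[[? ?] ?] ?].
  by move=> [? ? ? ?].
have S0 : (S !=set0)%classic.
  by exists (1, 0, 0); apply/SP; split; rewrite ?lexx ?ler01 // mulr0 !addr0.
have cptS : compact S.
  apply: compact_closedI.
    by do !apply: compact_setX.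
  apply: closed_comp; last exact: closed_eq.
  move=> x _; apply: cvgD; last by apply: cvgM; [exact: cvg_cst|exact: cvg_snd].
  by apply: cvgD; apply: cvg_comp; try exact: cvg_fst; exact: cvg_snd.
have [|[[a b] c] /set_mem/SP[a01 b01 c01 abc] max] :=
    @compact_EVT_max _ R (fun x : R * R * R => objective q M x.1.1 x.1.2 x.2) S S0 cptS.
  apply: continuous_subspaceT; exact: objective_continuous.
exists (objective q M a b c); split.
  exists a, b, c; split=> //; [by case/andP: a01|by case/andP: b01|by case/andP: c01].
move=> _ [a' [b' [c' [a0 b0 c0 abc' ->]]]].
(* For [M <= 1] the constraint does not bound [c'], but the objective does not
   depend on it. *)
have [M1|M1] := leqP M 1.
  have M0 : (M - 1 = 0)%N by lia.
  have -> : objective q M a' b' c' = objective q M a' b' 0.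
    rewrite /objective; congr (_ * _); apply: eq_bigr => i _; apply: eq_bigr => j _.
    rewrite M0; case: (q + 1 - i - j)%N => [|k]; first by rewrite !expr0.
    by rewrite bin0n !mulr0 !mul0r.
  apply: (max (a', b', 0)); apply/mem_set/SP.
  move: abc'; rewrite M0 !mul0r; split; [lra|lra|by rewrite lexx ler01|lra].
apply: (max (a', b', c')); apply/mem_set/SP.
have M1' : 1 <= (M - 1)%:R :> R by rewrite ler1n; lia.
split=> //; nra.
Qed.

End ObjectiveMaximum.

Lemma objective_le_PG2_density (R : realType) (F : finFieldType) (N : nat)
    (a b c : R) : (N < M_arc F)%N ->
  0 <= a -> 0 <= b -> 0 <= c -> a + b + N%:R * c = 1 ->
  objective #|F| N.+1 a b c <= turan_density R #|F|.+1 (PG2 F).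
Proof.
move=> NM a0 b0 c0 abc; apply: objective_le_turan_density => //.
exact: PG2_not_well_coloured.
Qed.

(** The lower limit [q + 2 - i] of the inner sum exceeds its upper limit. This settles [M = 0],
    where [M] is not of the form [N.+1]. *)
Lemma objective_M0 (R : realType) (q : nat) (a b c : R) : objective q 0 a b c = 0.
Proof.
rewrite /objective big_nat big1 ?mulr0 // => i /andP[i1 iq].
by rewrite big_geq //; lia.
Qed.

Lemma PG2_density_ge_max (R : realType) (F : finFieldType) :
  exists2 m : R, is_max (objective_values R #|F| (M_arc F)) m
               & turan_density R #|F|.+1 (PG2 F) >= m.
Proof.
have [m mmax] := objective_values_max R #|F| (M_arc F); exists m => //.
case: mmax => -[a [b [c [a0 b0 c0 abc ->]]]] _.
case E : (M_arc F) => [|N].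
  rewrite objective_M0; apply: turan_density_ge => [|n]; last by rewrite mul0r.
  apply/set0Pn; exists (line_of (pid_mx 2)); apply/imsetP; exists (pid_mx 2) => //.
  by rewrite inE rank_pid_mx.
by apply: objective_le_PG2_density; rewrite ?E //; move: abc; rewrite E subSS subn0.
Qed.

(** * Numerical evaluation of the objective *)

Lemma natr_factS (R : realType) (n : nat) : (n.+1)`!%:R = n.+1%:R * n`!%:R :> R.
Proof. by rewrite factS natrM. Qed.

(** Reduces the goal to an inequality between explicit rationals. The decimals stay folded while
    ranges, binomials and exponents are computed, and factorials are split into small factors. *)
Ltac eval_objective :=
  match goal with |- is_true (?d <= objective _ _ ?a ?b ?c) =>
    let x := fresh "a" in let y := fresh "b" in
    let z := fresh "c" in let w := fresh "d" in
    set w := d; set x := a; set y := b; set z := c;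
    rewrite /objective;
    repeat match goal with
    | |- context [index_iota ?m ?n] =>
        let s := eval vm_compute in (index_iota m n) in
        change (index_iota m n) with s; rewrite ?big_cons
    end;
    rewrite !big_nil;
    repeat match goal with
    | |- context ['C(?m, ?n)] =>
        let v := eval vm_compute in 'C(m, n) in change 'C(m, n) with v
    | |- context [?x ^+ ?n] =>
        let v := eval vm_compute in n in
        progress change (x ^+ n) with (x ^+ v)
    | |- context [?n `!] =>
        let v := eval vm_compute in n in
        progress change (n `!) with (v `!)
    end;
    rewrite !natr_factS !fact0;
    rewrite /w /x /y /z /decimal; cbn [foldr]
  end.

(* The arguments are approximate maximisers, rounded so that
   [a + b + (q - 2) * c = 1] holds exactly. *)
Lemma objective_ge_3 (R : realType) :
  decimal R [:: 7; 3; 6; 4; 7; 1; 9; 0; 5; 5]%N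
  <= objective 3 2 (decimal R [:: 5; 9; 4; 8; 6]%N)
       (decimal R [:: 3; 2; 1; 6; 0]%N) (decimal R [:: 0; 8; 3; 5; 4]%N).
Proof. by eval_objective; lra. Qed.

Lemma objective_ge_4 (R : realType) :
  decimal R [:: 7; 3; 8; 1; 6; 1; 1; 2; 7; 4]%N
  <= objective 4 3 (decimal R [:: 6; 5; 6; 6; 2]%N)
       (decimal R [:: 2; 2; 9; 7; 8]%N) (decimal R [:: 0; 5; 6; 8; 0]%N).
Proof. by eval_objective; lra. Qed.

Lemma objective_ge_5 (R : realType) :
  decimal R [:: 7; 4; 4; 0; 3; 8; 8; 1; 1; 7]%N
  <= objective 5 4 (decimal R [:: 7; 0; 0; 0; 8; 3]%N)
       (decimal R [:: 1; 7; 5; 0; 1; 2]%N) (decimal R [:: 0; 4; 1; 6; 3; 5]%N).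
Proof. by eval_objective; lra. Qed.

Lemma objective_ge_7 (R : realType) :
  decimal R [:: 7; 5; 8; 3; 6; 6; 1; 1; 4; 7]%N
  <= objective 7 6 (decimal R [:: 7; 5; 7; 8; 9; 0]%N)
       (decimal R [:: 1; 1; 4; 2; 7; 0]%N) (decimal R [:: 0; 2; 5; 5; 6; 8]%N).
Proof. by eval_objective; lra. Qed.

Lemma objective_ge_8 (R : realType) :
  decimal R [:: 7; 6; 5; 4; 1; 6; 0; 8; 2; 2]%N
  <= objective 8 7 (decimal R [:: 7; 7; 8; 2; 7; 2]%N)
       (decimal R [:: 0; 9; 6; 0; 5; 8]%N) (decimal R [:: 0; 2; 0; 9; 4; 5]%N).
Proof. by eval_objective; lra. Qed.

Lemma decimal_ge0 (R : realType) (ds : seq nat) : 0 <= decimal R ds.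
Proof.
by elim: ds => //= d ds IH; rewrite divr_ge0 ?addr_ge0 ?ler0n.
Qed.

(** For [q = N.+2], the bound M(q) >= q - 1 allows [N] classes C_k whatever the exact value of M(q),
    so the objective is evaluated with [q - 1] in place of M(q). *)
Lemma PG2_density_ge_objective (R : realType) (F : finFieldType) (N : nat)
    (a b c : seq nat) :
  N.+2 \in [:: 3; 4; 5; 7; 8]%N -> #|F| = N.+2 ->
  decimal R a + decimal R b + N%:R * decimal R c = 1 ->
  objective N.+2 N.+1 (decimal R a) (decimal R b) (decimal R c)
  <= turan_density R N.+3 (PG2 F).
Proof.
move=> N5 FN abc; rewrite -FN; apply: objective_le_PG2_density;
  rewrite ?decimal_ge0 //.
by have := @M_arc_ge F; rewrite FN; apply.
Qed.

Theorem theorem1p4 (R : realType) :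
  (forall (q : nat) (F : finFieldType), #|F| = q ->
     exists2 m : R, is_max (objective_values R q (M_arc F)) m
                  & turan_density R q.+1 (PG2 F) >= m) /\
  [/\ forall F : finFieldType, #|F| = 3%N ->
           turan_density R 4 (PG2 F) >= decimal R [:: 7; 3; 6; 4; 7; 1; 9; 0; 5; 5]%N,
      forall F : finFieldType, #|F| = 4%N ->
           turan_density R 5 (PG2 F) >= decimal R [:: 7; 3; 8; 1; 6; 1; 1; 2; 7; 4]%N,
      forall F : finFieldType, #|F| = 5%N ->
           turan_density R 6 (PG2 F) >= decimal R [:: 7; 4; 4; 0; 3; 8; 8; 1; 1; 7]%N,
      forall F : finFieldType, #|F| = 7%N ->
           turan_density R 8 (PG2 F) >= decimal R [:: 7; 5; 8; 3; 6; 6; 1; 1; 4; 7]%N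
    & forall F : finFieldType, #|F| = 8%N ->
           turan_density R 9 (PG2 F) >= decimal R [:: 7; 6; 5; 4; 1; 6; 0; 8; 2; 2]%N].
Proof.
split; first by move=> q F <-; exact: PG2_density_ge_max.
split=> F FN.
- apply: le_trans (objective_ge_3 R) _; apply: (@PG2_density_ge_objective R F 1) => //.
  by rewrite /decimal; cbn [foldr]; lra.
- apply: le_trans (objective_ge_4 R) _; apply: (@PG2_density_ge_objective R F 2) => //.
  by rewrite /decimal; cbn [foldr]; lra.
- apply: le_trans (objective_ge_5 R) _; apply: (@PG2_density_ge_objective R F 3) => //.
  by rewrite /decimal; cbn [foldr]; lra.
- apply: le_trans (objective_ge_7 R) _; apply: (@PG2_density_ge_objective R F 5) => //.
  by rewrite /decimal; cbn [foldr]; lra.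
apply: le_trans (objective_ge_8 R) _; apply: (@PG2_density_ge_objective R F 6) => //.
by rewrite /decimal; cbn [foldr]; lra.
Qed.
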